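(* Let $\phi,\psi$ be modal formulas. (1) All type elimination sequences for $\phi,\psi$ end in the same quasi-model $\mathcal X_n$, which is the maximal quasi-model (w.r.t. inclusion) and equals the union of all quasi-models. (2) $\phi\land\neg\psi$ is satisfiable if and only if this $\mathcal X_n$ contains a type $\tau=(\tau_L,\tau_R)$ with $\mathrm{nnf}(\phi)\in\tau_L$ and $\mathrm{nnf}(\neg\psi)\in\tau_R$.
   Context: $\mathrm{nnf}(\chi)$ is the negation normal form of $\chi$ (negations only in front of letters). For $\chi$ in NNF, $\mathrm{SUBF}(\chi)$ is the set of its subformulas, except that $\mathrm{SUBF}(\neg p)=\{\neg p\}$ (does not contain $p$). $X\subseteq\mathrm{SUBF}(\chi)$ is locally consistent if conjunctions in $X$ have both conjuncts in $X$, disjunctions in $X$ have a disjunct in $X$, $\bot\notin X$, and $X$ contains no $p,\neg p$ pair. L-types: locally consistent subsets of $\mathrm{SUBF}(\mathrm{nnf}(\phi))$; R-types: locally consistent subsets of $\mathrm{SUBF}(\mathrm{nnf}(\neg\psi))$; types: pairs $(\tau_L,\tau_R)$. A type is overlap-consistent if no letter $p$ has $p$ in one component and $\neg p$ in the other. $\tau\Rightarrow\tau'$ (for combined types) means: for $D\in\{L,R\}$, $\Box\chi\in\tau_D$ implies $\chi\in\tau'_D$. A quasi-model is a set $\mathcal X$ of types such that (1) each member is overlap-consistent and (2) for every $\tau\in\mathcal X$, $D\in\{L,R\}$, $\Diamond\chi\in\tau_D$, there is $\tau'\in\mathcal X$ with $\tau\Rightarrow\tau'$ and $\chi\in\tau'_D$.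 A type elimination sequence is $\mathcal X_0,\dots,\mathcal X_n$ where $\mathcal X_0$ is the set of all types, each $\mathcal X_{i+1}$ is obtained from $\mathcal X_i$ by removing one type of $\mathcal X_i$ that fails condition (1) or (2) (relative to $\mathcal X_i$), and $\mathcal X_n$ is a quasi-model. *)

(* Defs.v *)
From HB Require Import structures.
From mathcomp Require Import all_boot.
From mathcomp Require Import finmap.

Set Implicit Arguments.
Unset Strict Implicit.
Unset Printing Implicit Defensive.

Local Open Scope fset_scope.

Inductive form (P : Type) : Type :=
| Var of P
| Top
| Bot
| Neg of form P
| And of form P & form P
| Or of form P & form P
| Dia of form P
| Box of form P.

Arguments Top {P}.
Arguments Bot {P}.

Fixpoint form_encode (P : Type) (chi : form P) : GenTree.tree P :=
  match chi with
  | Var p => GenTree.Leaf p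
  | Top => GenTree.Node 0 [::]
  | Bot => GenTree.Node 1 [::]
  | Neg a => GenTree.Node 2 [:: form_encode a]
  | And a b => GenTree.Node 3 [:: form_encode a; form_encode b]
  | Or a b => GenTree.Node 4 [:: form_encode a; form_encode b]
  | Dia a => GenTree.Node 5 [:: form_encode a]
  | Box a => GenTree.Node 6 [:: form_encode a]
  end.

Fixpoint form_decode (P : Type) (t : GenTree.tree P) : form P :=
  match t with
  | GenTree.Leaf p => Var p
  | GenTree.Node 0 _ => Top
  | GenTree.Node 2 [:: a] => Neg (form_decode a)
  | GenTree.Node 3 [:: a; b] => And (form_decode a) (form_decode b)
  | GenTree.Node 4 [:: a; b] => Or (form_decode a) (form_decode b)
  | GenTree.Node 5 [:: a] => Dia (form_decode a)
  | GenTree.Node 6 [:: a] => Box (form_decode a)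
  | _ => Bot
  end.

Lemma form_encodeK (P : Type) : cancel (@form_encode P) (@form_decode P).
Proof. by elim=> //= [a ->|a -> b ->|a -> b ->|a ->|a ->]. Qed.

HB.instance Definition _ (P : choiceType) :=
  Choice.copy (form P) (can_type (@form_encodeK P)).

(* [V p w] reads "the letter p is true at the world w". *)
Fixpoint sat (P W : Type) (R : W -> W -> Prop) (V : P -> W -> Prop)
    (w : W) (chi : form P) : Prop :=
  match chi with
  | Var p => V p w
  | Top => True
  | Bot => False
  | Neg a => ~ sat R V w a
  | And a b => sat R V w a /\ sat R V w b
  | Or a b => sat R V w a \/ sat R V w b
  | Dia a => exists2 v, R w v & sat R V v a
  | Box a => forall v, R w v -> sat R V v a
  end.

Definition satisfiable (P : Type) (chi : form P) : Prop :=
  exists (W : Type) (R : W -> W -> Prop) (V : P -> W -> Prop) (w : W),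
    sat R V w chi.

(* [nnf_sign true chi] is the negation normal form of [chi], and
   [nnf_sign false chi] that of [Neg chi]. *)
Fixpoint nnf_sign (P : Type) (s : bool) (chi : form P) : form P :=
  match chi with
  | Var p => if s then Var p else Neg (Var p)
  | Top => if s then Top else Bot
  | Bot => if s then Bot else Top
  | Neg a => nnf_sign (~~ s) a
  | And a b => (if s then @And P else @Or P) (nnf_sign s a) (nnf_sign s b)
  | Or a b => (if s then @Or P else @And P) (nnf_sign s a) (nnf_sign s b)
  | Dia a => (if s then @Dia P else @Box P) (nnf_sign s a)
  | Box a => (if s then @Box P else @Dia P) (nnf_sign s a)
  end.

Definition nnf (P : Type) (chi : form P) : form P := nnf_sign true chi.

(* Meant for formulas in negation normal form, where [Neg] only occurs in front
   of a letter; the letter p is not counted as a subformula of [Neg (Var p)]. *)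
Fixpoint subf (P : choiceType) (chi : form P) : {fset form P} :=
  match chi with
  | And a b | Or a b => chi |` (subf a `|` subf b)
  | Dia a | Box a => chi |` subf a
  | Var _ | Top | Bot | Neg _ => [fset chi]
  end.

Definition locally_consistent (P : choiceType) (X : {fset form P}) : bool :=
  [forall chi : X,
    match fsval chi with
    | And a b => (a \in X) && (b \in X)
    | Or a b => (a \in X) || (b \in X)
    | Bot => false
    | Var p => Neg (Var p) \notin X
    | _ => true
    end].

Definition lc_subsets (P : choiceType) (chi : form P) : {fset {fset form P}} :=
  [fset X in fpowerset (subf chi) | locally_consistent X].

Notation preType P := ({fset form P} * {fset form P})%type.

Definition types (P : choiceType) (phi psi : form P) : {fset preType P} :=
  lc_subsets (nnf phi) `*` lc_subsets (nnf (Neg psi)).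

Inductive side := L | R.

Definition component (P : choiceType) (D : side) (tau : preType P) :
    {fset form P} :=
  match D with L => tau.1 | R => tau.2 end.

Definition overlap_consistent (P : choiceType) (tau : preType P) : Prop :=
  forall p : P,
    ~ (Var p \in component L tau /\ Neg (Var p) \in component R tau) /\
    ~ (Neg (Var p) \in component L tau /\ Var p \in component R tau).

Definition succ_type (P : choiceType) (tau tau' : preType P) : Prop :=
  forall (D : side) (chi : form P),
    Box chi \in component D tau -> chi \in component D tau'.

Definition diamonds_witnessed (P : choiceType) (X : {fset preType P})
    (tau : preType P) : Prop :=
  forall (D : side) (chi : form P), Dia chi \in component D tau ->
    exists2 tau', tau' \in X & succ_type tau tau' /\ chi \in component D tau'.

Definition quasi_model (P : choiceType) (phi psi : form P)
    (X : {fset preType P}) : Prop :=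
  X `<=` types phi psi /\
  forall tau, tau \in X -> overlap_consistent tau /\ diamonds_witnessed X tau.

Definition elimination_step (P : choiceType) (X Y : {fset preType P}) : Prop :=
  exists2 tau, tau \in X &
    ~ (overlap_consistent tau /\ diamonds_witnessed X tau) /\ Y = X `\ tau.

(* The sequence is X 0, ..., X n; the values of [X] beyond [n] are irrelevant. *)
Definition elimination_sequence (P : choiceType) (phi psi : form P)
    (n : nat) (X : nat -> {fset preType P}) : Prop :=
  [/\ X 0 = types phi psi,
      forall i, i < n -> elimination_step (X i) (X i.+1)
    & quasi_model phi psi (X n)].

(* Main.v *)
(** A type lying in some quasi-model is never eliminated, since its witnesses lie
    in that quasi-model too; so every elimination sequence ends in the largest
    quasi-model. A quasi-model becomes a Kripke model with its types as worlds;
    conversely, the types realised in a Kripke model form a quasi-model. *)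
Require Import Defs.
From mathcomp Require Import all_boot finmap boolp.

Local Open Scope fset_scope.

Set Implicit Arguments.
Unset Strict Implicit.
Unset Printing Implicit Defensive.

(** Pushing a negation inwards flips the sign, so one induction over both signs covers [Neg]; the
    cases with sign [false] are the classical dualities. The statement is an equality of
    propositions so that induction hypotheses can be used for rewriting. *)
Lemma sat_nnf_sign (P W : Type) (Rel : W -> W -> Prop) (V : P -> W -> Prop)
    (chi : form P) (s : bool) (w : W) :
  sat Rel V w (nnf_sign s chi) =
    if s then sat Rel V w chi else ~ sat Rel V w chi.
Proof.
elim: chi s w => [p|||a IHa|a IHa b IHb|a IHa b IHb|a IHa|a IHa] s w.
- by case: s.
- by case: s => //=; rewrite not_True.
- by case: s => //=; rewrite not_False.
- by rewrite /= IHa; case: s; rewrite //= notK.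
- by case: s; rewrite /= IHa IHb // not_andE.
- by case: s; rewrite /= IHa IHb // not_orE.
- case: s; rewrite /=; apply/propext.
    by split=> -[v Rwv av]; exists v => //; move: av; rewrite IHa.
  split=> [h [v Rwv]|h v Rwv]; first by have := h v Rwv; rewrite IHa.
  by rewrite IHa => av; apply: h; exists v.
- case: s; rewrite /=; apply/propext.
    by split=> h v /h; rewrite IHa.
  split=> [[v Rwv] + h|h]; first by rewrite IHa; apply; apply: h.
  apply: contrapT => nex; apply: h => v Rwv.
  by apply: contrapT => nav; apply: nex; exists v => //; rewrite IHa.
Qed.

Section Subformulas.
Variable P : choiceType.
Implicit Types (chi a b c : form P) (X : {fset form P}).

Definition locally_closed X : Prop :=
  forall chi, chi \in X ->
    match chi with
    | And a b => (a \in X) && (b \in X)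
    | Or a b => (a \in X) || (b \in X)
    | Bot => false
    | Var p => Neg (Var p) \notin X
    | _ => true
    end.

Lemma locally_consistentP X : reflect (locally_closed X) (locally_consistent X).
Proof.
apply: (iffP forallP) => [h chi chiX|h chi]; first exact: (h [` chiX]).
exact: h (fsvalP chi).
Qed.

Lemma subf_refl chi : chi \in subf chi.
Proof. by case: chi => *; rewrite /= ?inE ?eqxx. Qed.

Lemma subf_trans a b c : a \in subf b -> b \in subf c -> a \in subf c.
Proof.
move=> ab; elim: c => [p|||c _|c IHc d IHd|c IHc d IHd|c IHc|c IHc] /=;
  rewrite !inE.
1-4: by move/eqP=> e; move: ab; rewrite e /= inE.
1-2: case/or3P=> [/eqP e|/IHc->|/IHd->]; rewrite ?orbT //;
  by move: ab; rewrite e /= !inE.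
all: by case/orP=> [/eqP e|/IHc->]; rewrite ?orbT //; move: ab; rewrite e /= !inE.
Qed.

Lemma mem_lc_subsets chi X :
  (X \in lc_subsets chi) = (X `<=` subf chi) && locally_consistent X.
Proof. by rewrite !inE fpowersetE. Qed.

End Subformulas.

Section Elimination.
Variables (P : choiceType) (phi psi : form P).
Implicit Types (X Y : {fset preType P}) (tau : preType P).

Lemma diamonds_witnessed_mono X Y tau :
  X `<=` Y -> diamonds_witnessed X tau -> diamonds_witnessed Y tau.
Proof.
move=> /fsubsetP XY h D chi /h [tau' tauX hs].
by exists tau' => //; apply: XY.
Qed.

Lemma elimination_step_quasi_model X X' Y :
  elimination_step X X' -> quasi_model phi psi Y -> Y `<=` X -> Y `<=` X'.
Proof.
move=> [tau tauX [bad ->]] [_ qY] YX.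
rewrite fsubsetD1 YX /=; apply/negP => /qY [ov dw].
by apply: bad; split=> //; apply: diamonds_witnessed_mono dw.
Qed.

Lemma elimination_sequence_max n (X : nat -> {fset preType P}) Y :
  elimination_sequence phi psi n X -> quasi_model phi psi Y -> Y `<=` X n.
Proof.
move=> [X0 step _] qY.
suff: forall i, i <= n -> Y `<=` X i by apply.
elim=> [_|i IHi ltin]; first by rewrite X0; case: qY.
exact: elimination_step_quasi_model (step i ltin) qY (IHi (ltnW ltin)).
Qed.

(** Each step shrinks a finite set, so induction on cardinality ends the process. The starting set
    is arbitrary because the induction resumes from what one removal leaves. *)
Lemma elimination_from X :
  X `<=` types phi psi ->
  exists n (Z : nat -> {fset preType P}),
    [/\ Z 0 = X, forall i, i < n -> elimination_step (Z i) (Z i.+1)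
      & quasi_model phi psi (Z n)].
Proof.
have [m] := ubnP #|` X|; elim: m X => // m IHm X ltXm Xtypes.
have [qX|nqX] := pselect (quasi_model phi psi X); first by exists 0, (fun=> X).
have [tau tauX bad] : exists2 tau, tau \in X &
    ~ (overlap_consistent tau /\ diamonds_witnessed X tau).
  apply: contrapT => nex; apply: nqX; split=> // tau tauX.
  by apply: contrapT => bad; apply: nex; exists tau.
have [||n [Z [Z0 stepZ qZ]]] := IHm (X `\ tau).
- by move: ltXm; rewrite (cardfsD1 tau X) tauX.
- exact: fsubset_trans (fsubD1set _ _) Xtypes.
(* [X] is put in front and the sequence [Z] shifted by one index; the new step 0 removes [tau]. *)
exists n.+1, (fun i => if i is j.+1 then Z j else X); split=> // -[_|i /stepZ //].
by exists tau; rewrite ?Z0.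
Qed.

End Elimination.

(* Truth lemma. The sign lets the induction run on [chi] instead of on its
   negation normal form. *)
Lemma quasi_model_sat (P : choiceType) (phi psi : form P)
    (X : {fset preType P}) (chi : form P) (s : bool) (D : side)
    (tau : preType P) :
  quasi_model phi psi X -> tau \in X -> nnf_sign s chi \in component D tau ->
  let Rel tau tau' := tau' \in X /\ succ_type tau tau' in
  let V p tau := exists D, Var p \in component D tau in
  if s then sat Rel V tau chi else ~ sat Rel V tau chi.
Proof.
move=> [/fsubsetP Xtypes qX] tauX + Rel V.
have lc D' tau' : tau' \in X -> locally_closed (component D' tau').
  move=> /Xtypes; rewrite in_fsetM !mem_lc_subsets => /andP[].
  by move=> /andP[_ /locally_consistentP h1] /andP[_ /locally_consistentP h2];
     case: D'.
elim: chi s D tau tauX => [p|||a IHa|a IHa b IHb|a IHa b IHb|a IHa|a IHa] s D tau tauX.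
- case: s => /= [pD|npD [D' pD']]; first by exists D.
  (* A letter is true if either component contains it: a clash within one component breaks local
     consistency, a clash across the two breaks overlap consistency. *)
  have [ov _] := qX _ tauX; have /= npX := lc D' tau tauX _ pD'.
  by case: D D' npD pD' npX (ov p) => -[] /= -> -> // _ [h1 h2];
     [apply: h2 | apply: h1].
- by case: s => //= /(lc _ _ tauX).
- by case: s => //= [/(lc _ _ tauX)|_ []].
- case: s => /= /(IHa _ _ _ tauX) //=.
  by move=> h /(_ h).
- case: s => /= /(lc _ _ tauX) => [/andP[]|/orP[]].
  + by move=> /(IHa _ _ _ tauX) ? /(IHb _ _ _ tauX).
  + by move=> /(IHa _ _ _ tauX) /= h [].
  + by move=> /(IHb _ _ _ tauX) /= h [].
- case: s => /= /(lc _ _ tauX) => [/orP[]|/andP[]].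
  + by move=> /(IHa _ _ _ tauX) ?; left.
  + by move=> /(IHb _ _ _ tauX) ?; right.
  + by move=> /(IHa _ _ _ tauX) /= ha /(IHb _ _ _ tauX) /= hb [].
(* With sign [false], [Dia a] occurs in the type as a box, which [succ] passes on to every
   successor; in the next case, [Box a] with sign [false] occurs as a diamond and needs a
   witness. *)
- case: s => /= [aD|aD [v [vX succ] va]].
    have [_ /(_ _ _ aD) [v vX [succ av]]] := qX _ tauX.
    by exists v => //; apply: IHa av.
  exact: (IHa false D v vX (succ _ _ aD)) va.
- case: s => /= [aD v [vX succ]|aD h].
    exact: (IHa true D v vX (succ _ _ aD)).
  have [_ /(_ _ _ aD) [v vX [succ av]]] := qX _ tauX.
  exact: (IHa false D v vX av) (h v (conj vX succ)).
Qed.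

Section RealisedTypes.
Variables (P : choiceType) (phi psi : form P).
Variables (W : Type) (Rel : W -> W -> Prop) (V : P -> W -> Prop).

Definition theory (chi : form P) (w : W) : {fset form P} :=
  [fset a in subf chi | `[< sat Rel V w a >]].

Definition realised_type (w : W) : preType P :=
  (theory (nnf phi) w, theory (nnf (Neg psi)) w).

(** [W] may be infinite, so the set is carved out of the finite set of all types instead of being
    formed as an image of [W]. *)
Definition realised_types : {fset preType P} :=
  [fset tau in types phi psi | `[< exists w, tau = realised_type w >]].

Lemma theoryP chi w a :
  a \in theory chi w <-> a \in subf chi /\ sat Rel V w a.
Proof.
rewrite !inE /=; split=> [/andP[-> /asboolP]//|[-> h]].
exact/asboolP.
Qed.

(** Local consistency mirrors the truth clauses at [w]; [subf_trans] keeps the conjuncts and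
    disjuncts inside [subf chi]. *)
Lemma theory_lc chi w : theory chi w \in lc_subsets chi.
Proof.
rewrite mem_lc_subsets; apply/andP; split.
  by apply/fsubsetP => a /theoryP[].
apply/locally_consistentP => -[p|||a|a b|a b|a|a] /theoryP[] // sub /=.
- by move=> Vp; apply/negP => /theoryP[_ /(_ Vp)].
- move=> [ha hb]; apply/andP; split; apply/theoryP; split=> //;
    by apply: subf_trans sub; rewrite /= !inE subf_refl ?orbT.
- move=> h; apply/orP; case: h => h; [left|right]; apply/theoryP; split=> //;
    by apply: subf_trans sub; rewrite /= !inE subf_refl ?orbT.
Qed.

Lemma realised_typeP D w a :
  a \in component D (realised_type w) <->
    a \in subf (nnf (if D is L then phi else Neg psi)) /\ sat Rel V w a.
Proof. by case: D; apply: theoryP. Qed.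

Lemma mem_realised_types w : realised_type w \in realised_types.
Proof.
rewrite in_fset inE /= in_fsetM !theory_lc; by apply/asboolP; exists w.
Qed.

Lemma realised_types_quasi_model : quasi_model phi psi realised_types.
Proof.
split=> [|tau]; first by apply/fsubsetP => tau; rewrite inE => /andP[].
rewrite inE => /andP[_ /asboolP[w ->]]; split.
  by move=> p; split=> -[/realised_typeP[_ h] /realised_typeP[_ k]]; [exact: k | exact: h].
move=> D chi /realised_typeP[sub /= [v Rwv satv]].
(* The world [v] verifying the diamond supplies the witness: boxes true at [w] hold at [v], in both
   components at once. *)
exists (realised_type v); first exact: mem_realised_types.
split=> [D' a /realised_typeP[sub' h]|]; apply/realised_typeP; split=> //.
- by apply: subf_trans sub'; rewrite /= !inE subf_refl orbT.
- exact: h.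
- by apply: subf_trans sub; rewrite /= !inE subf_refl orbT.
Qed.

End RealisedTypes.

Unset Implicit Arguments.

Theorem theorem43 (P : choiceType) (phi psi : form P) :
  exists Xn : {fset preType P},
    [/\ exists (n : nat) (X : nat -> {fset preType P}),
          elimination_sequence phi psi n X,
        forall (n : nat) (X : nat -> {fset preType P}),
          elimination_sequence phi psi n X -> X n = Xn,
        quasi_model phi psi Xn /\
          (forall Y : {fset preType P}, quasi_model phi psi Y -> Y `<=` Xn),
        forall tau : preType P,
          tau \in Xn <-> exists2 Y, quasi_model phi psi Y & tau \in Y
      & satisfiable (And phi (Neg psi)) <->
          exists2 tau : preType P, tau \in Xn &
            nnf phi \in component L tau /\ nnf (Neg psi) \in component R tau].
Proof.
have [n [X seqX]] := elimination_from (fsubset_refl (types phi psi)).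
have maxX Y : quasi_model phi psi Y -> Y `<=` X n.
  exact: elimination_sequence_max seqX.
have [_ _ qX] := seqX.
exists (X n); split=> //.
- by exists n, X.
(* Both final sets are quasi-models and each contains every quasi-model, so they contain each
   other. *)
- move=> m Z seqZ; apply/eqP; rewrite eqEfsubset.
  have [_ _ qZ] := seqZ.
  by rewrite maxX // (elimination_sequence_max seqZ qX).
- move=> tau; split=> [tauX|[Y /maxX /fsubsetP YX]]; first by exists (X n).
  exact: YX.
split=> [[W [Rel [V [w [hphi hpsi]]]]]|[tau tauX [hphi hpsi]]].
  exists (realised_type phi psi Rel V w).
    apply: (fsubsetP (maxX _ (realised_types_quasi_model phi psi Rel V))).
    exact: mem_realised_types.
  split; apply/realised_typeP; split; first exact: subf_refl.
  - by rewrite sat_nnf_sign.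
  - exact: subf_refl.
  - by rewrite sat_nnf_sign.
(* All pairs serve as worlds, but accessibility only leads into [X n], which also contains [tau].
   Relation and valuation are holes filled by unification with the truth lemma. *)
exists (preType P); do 2 eexists; exists tau; split.
  exact: (quasi_model_sat (s := true) (D := L) qX tauX hphi).
exact: (quasi_model_sat (chi := Neg psi) (s := true) (D := R) qX tauX hpsi).
Qed.
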